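(* Let $n,k,d$ be positive integers. (1) If there exists an integer cyclically $k$-diagonal $\mathrm{H}_k(n;k)$ with $n\geq k+4$, then there exists an integer cyclically $(k+4)$-diagonal $\mathrm{H}_{k+4}(n;k+4)$. (2) If there exists an integer cyclically $(2,d)$-diagonal $\mathrm{H}_{2d}(n;2d)$ with $n\geq 2d+4$, then there exists an integer cyclically $(2,d+2)$-diagonal $\mathrm{H}_{2d+4}(n;2d+4)$. (3) If there exists an integer cyclically $(2,d)$-diagonal $\mathrm{H}_{2d-1}(n;2d-1)$ with $n\equiv 0\pmod 4$ and $n\geq 2d+6$, then there exists an integer cyclically $(2,d+3)$-diagonal $\mathrm{H}_{2d+5}(n;2d+5)$.
   Context: A partially filled (p.f.) $m\times n$ array is an $m\times n$ matrix in which some cells are allowed to be empty. Let $n,k,t$ be positive integers such that $t$ divides $2nk$, let $v=2nk+t$, and let $J$ be the subgroup of $\mathbb{Z}_v$ of order $t$. An $\mathrm{H}_t(n;k)$ (square Heffter array over $\mathbb{Z}_v$ relative to $J$) is an $n\times n$ p.f. array with elements in $\mathbb{Z}_v$ such that: each row and each column contains exactly $k$ filled cells; for every $x\in\mathbb{Z}_v\setminus J$, either $x$ or $-x$ appears in the array; the elements in every row and every column sum to $0$ in $\mathbb{Z}_v$. It is called integer if the elements in every row and every column, viewed as integers in $\pm\{1,\ldots,\lfloor\frac{2nk+t}{2}\rfloor\}$, sum to zero in $\mathbb{Z}$. For an $n\times n$ array and $i\in\{1,\ldots,n\}$, the $i$-th diagonal is $D_i=\{(i,1),(i+1,2),\ldots,(i-1,n)\}$,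 with row and column indices taken modulo $n$ in $\{1,\ldots,n\}$; the diagonals $D_i,D_{i+1},\ldots,D_{i+k-1}$ (indices modulo $n$) are called $k$ consecutive diagonals. A square p.f. array of size $n\ge k$ is cyclically $k$-diagonal if its nonempty cells are exactly those of $k$ consecutive diagonals. A p.f. array $S$ is cyclically $(s,k)$-diagonal if it is obtained as follows: take a cyclically $k$-diagonal $N\times N$ p.f. array $A$; replace each cell of $A$ with an $s\times s$ (partially filled) array which is totally empty if the corresponding cell of $A$ is empty, obtaining an $sN\times sN$ array with columns $\overline{C}_1,\ldots,\overline{C}_{sN}$; let $S$ be any array whose ordered columns are $\overline{C}_i,\overline{C}_{i+1},\ldots,\overline{C}_{sN},\overline{C}_1,\ldots,\overline{C}_{i-1}$ for some $i\in\{1,\ldots,sN\}$. *)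

(* Defs.v *)
From HB Require Import structures.
From mathcomp Require Import all_boot all_order all_fingroup all_algebra.

Set Implicit Arguments.
Unset Strict Implicit.
Unset Printing Implicit Defensive.

Import GRing.Theory.
Local Open Scope ring_scope.

(* An empty cell is [None].  Rows, columns and diagonals are numbered from 0. *)
Definition pf_array (T : Type) (m n : nat) := 'M[option T]_(m, n).

Definition heffter_modulus (n k t : nat) : nat := (2 * n * k + t)%N.

Definition heffter_cells (n k t : nat) :=
  pf_array 'Z_(heffter_modulus n k t) n n.

Definition occurs (T : Type) (m n : nat) (A : pf_array T m n) (x : T) : Prop :=
  exists i j, A i j = Some x.

(* 'Z_v is cyclic, so it has exactly one subgroup J of order t when t divides
   v.  Since Z_v \ J consists of 2nk elements, none of them an involution, and
   the array has nk filled cells, the covering condition forces exactly one of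
   x, -x to appear, and to appear exactly once. *)
Definition is_heffter (n k t : nat) (A : heffter_cells n k t) : Prop :=
  [/\ [/\ (0 < n)%N, (0 < k)%N, (0 < t)%N & (t %| 2 * n * k)%N],
      (forall i, #|[set j | isSome (A i j)]| = k) /\
      (forall j, #|[set i | isSome (A i j)]| = k),
      (exists2 J : {group 'Z_(heffter_modulus n k t)}, #|J| = t &
         forall x, x \notin J -> occurs A x \/ occurs A (- x)),
      forall i, \sum_j odflt 0 (A i j) = 0
    & forall j, \sum_i odflt 0 (A i j) = 0].

(* The representative of x in +-{1, ..., v/2}.  The values 0 and, for v even,
   v/2, whose representative is missing or ambiguous, lie in J and so never
   occur in a Heffter array. *)
Definition signed_rep (v : nat) (x : 'Z_v) : int :=
  if (x <= v %/ 2)%N then Posz x else Posz x - Posz v.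

Definition is_integer_heffter (n k t : nat) (A : heffter_cells n k t) : Prop :=
  [/\ is_heffter A,
      forall i, \sum_j oapp (@signed_rep _) 0 (A i j) = 0
    & forall j, \sum_i oapp (@signed_rep _) 0 (A i j) = 0].

(* The index i is read modulo n. *)
Definition diagonal (n i : nat) : {set 'I_n * 'I_n} :=
  [set p : 'I_n * 'I_n | p.1 == (i + p.2)%N %[mod n]].

Definition cyclically_diagonal (T : Type) (n k : nat) (A : pf_array T n n) :
    Prop :=
  (k <= n)%N /\
  exists i : 'I_n, forall r c,
    isSome (A r c) = ((r, c) \in \bigcup_(j < k) diagonal n (i + j)).

(* C is the array obtained from A by putting the s x s array B a b in place of
   the cell (a, b). *)
Definition block_replacement (T : Type) (s N n : nat) (A : pf_array T N N)
    (B : 'I_N -> 'I_N -> pf_array T s s) (C : pf_array T n n) : Prop :=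
  [/\ n = (s * N)%N,
      forall a b, A a b = None -> B a b = const_mx None
    & forall (a b : 'I_N) (x y : 'I_s) (r c : 'I_n),
        r = (a * s + x)%N :> nat -> c = (b * s + y)%N :> nat ->
        C r c = B a b x y].

Definition rotate_columns (T : Type) (m n i : nat) (C : pf_array T m n) :
    pf_array T m n :=
  colsub (iter i (@ordS n)) C.

Definition cyclically_block_diagonal (T : Type) (n s k : nat)
    (S : pf_array T n n) : Prop :=
  exists (N : nat) (A : pf_array T N N)
         (B : 'I_N -> 'I_N -> pf_array T s s) (C : pf_array T n n) (i : 'I_n),
    [/\ cyclically_diagonal k A, block_replacement A B C
      & S = rotate_columns i C].

(* Main.v *)
(* An H_k(n;k) uses, up to sign, every integer of [1, (2n+1)k/2] that is not a
   multiple of 2n+1, so passing from k to k+q amounts to adding, in empty cells,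
   the nonmultiples of 2n+1 in ((2n+1)k/2, (2n+1)(k+q)/2) so that every row and
   column of the added cells sums to 0 in Z.

   On four consecutive diagonals this is done by the translates X, X+a, X+b,
   X+a+b of an interval X of n integers, with signs +, -, -, +.

   On 2 x 2 block diagonals it is done by blocks
     [  z      -(z+u)   ]
     [ -(z+v)   z+u+v   ]
   whose row sums are -u, u and whose column sums are -v, v: if (u, v) is
   constant along each block diagonal, the only condition is that the u's and
   the v's of the added block diagonals sum to 0.  The pairs are (1, n)
   and (-1, -n) for two block diagonals, and (-2, 1), (1, n), (1, -(n+1)) for
   three; the pair (-2, 1) splits intervals into quadruples of consecutive
   integers, which is where 4 | n is needed. *)
Require Import Defs.
From HB Require Import structures.
From mathcomp Require Import all_boot all_order all_fingroup all_algebra.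
From mathcomp Require Import cyclic zify ring.

Set Implicit Arguments.
Unset Strict Implicit.
Unset Printing Implicit Defensive.

Import Order.TTheory GRing.Theory Num.Theory.
Local Open Scope ring_scope.

(** * Signed representatives, and subgroups of the cyclic group *)

Lemma Zp_ltn (v : nat) (x : 'Z_v) : (1 < v)%N -> (x < v)%N.
Proof. by move=> v1; have := ltn_ord x; rewrite {2}Zp_cast. Qed.

Lemma signed_rep_le (v : nat) (x : 'Z_v) :
  (1 < v)%N -> (2 * `|signed_rep x| <= v)%N.
Proof.
by move=> v1; have := Zp_ltn x v1; rewrite /signed_rep; case: ifP; lia.
Qed.

Lemma signed_repK (v : nat) (x : 'Z_v) : (1 < v)%N -> (signed_rep x)%:~R = x.
Proof.
move=> v1; rewrite /signed_rep; case: ifP => _; rewrite ?rmorphB /= -!pmulrn.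
  exact: natr_Zp.
by rewrite pchar_Zp // subr0 natr_Zp.
Qed.

(** The strict bound excludes [z = - v/2], which would come back as [v/2]. *)
Lemma intr_signed_rep (v : nat) (z : int) :
  (1 < v)%N -> (2 * `|z| < v)%N -> signed_rep (z%:~R : 'Z_v) = z.
Proof.
move=> v1; case: z => z zv.
  rewrite /signed_rep -pmulrn val_Zp_nat // modn_small; last by lia.
  by case: ifP; lia.
(* The residue of a negative integer in this range exceeds [v/2], so the second branch of
   [signed_rep] applies. *)
have -> : (Negz z)%:~R = (v - z.+1)%:R :> 'Z_v.
  by rewrite natrB ?pchar_Zp ?sub0r ?NegzE ?mulrNz; last by lia.
rewrite /signed_rep val_Zp_nat // modn_small; last by lia.
by case: ifP; lia.
Qed.

(** By Lagrange's theorem [w * k] vanishes modulo [M * k], and [k] cancels. With [M = 2n+1] this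
    shows that nonmultiples of [2n+1] lie outside [J]. *)
Lemma dvdn_subgroup_Zp (v M k : nat) (J : {group 'Z_v}) (w : nat) :
  (1 < v)%N -> v = (M * k)%N -> #|J| = k -> w%:R \in J -> (M %| w)%N.
Proof.
move=> v1 vE cJ /order_dvdG; rewrite cJ order_dvdn => /eqP.
rewrite FinRing.zmodXgE -mulrnA => /(congr1 val); rewrite /= (val_Zp_nat v1).
move/eqP; rewrite -/(dvdn _ _) vE dvdn_pmul2r //.
by move: v1; rewrite vE; case: (k) => //; rewrite muln0.
Qed.

Lemma subgroup_Zp_exists (v M k : nat) : (1 < v)%N -> v = (M * k)%N ->
  exists2 J : {group 'Z_v}, #|J| = k & forall w : nat, (M %| w)%N -> w%:R \in J.
Proof.
move=> v1 vE; exists <[(M%:R : 'Z_v)]>%G => [|w /dvdnP[q ->]].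
  have o1 : #[(1%R : 'Z_v)]%g = v by rewrite order_Zp1 Zp_cast.
  rewrite -[#|_|]/#[_]%g -FinRing.zmodXgE orderXdiv o1 vE ?dvdn_mulr //.
  rewrite mulKn //.
  by move: v1; rewrite vE; case: (M) => //; rewrite mul0n.
by rewrite natrM mulr_natl -FinRing.zmodXgE mem_cycle.
Qed.

(** * Filling empty cells of a Heffter array with integers *)

(** Old entries change modulus through their signed representatives, which preserves the integer
    sums of lines. *)
Definition heffter_extension (n k k' : nat) (A : heffter_cells n k k)
    (E : 'I_n -> 'I_n -> option int) : heffter_cells n k' k' :=
  \matrix_(i, j) if A i j is Some x then Some (signed_rep x)%:~R
                 else omap intr (E i j).

Lemma heffter_extension_some (n k k' : nat) (A : heffter_cells n k k)
    (E : 'I_n -> 'I_n -> option int) (r c : 'I_n) :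
  isSome (heffter_extension k' A E r c) = isSome (A r c) || isSome (E r c).
Proof. by rewrite mxE; case: (A r c) => //; case: (E r c). Qed.

Lemma card_line_extension (n p q : nat) (f g h : 'I_n -> bool) :
  (forall j, h j = f j || g j) -> (forall j, g j -> ~~ f j) ->
  #|[set j | f j]| = p -> #|[set j | g j]| = q -> #|[set j | h j]| = (p + q)%N.
Proof.
move=> hE gf <- <-; have -> : [set j | h j] = [set j | f j] :|: [set j | g j].
  by apply/setP => j; rewrite !inE hE.
rewrite cardsU; have -> : [set j | f j] :&: [set j | g j] = set0.
  apply/setP => j; rewrite !inE; have := @gf j.
  by case: (g j) => [/(_ isT)/negbTE->|]; rewrite ?andbF.
by rewrite cards0 subn0.
Qed.

(** The sums modulo the new [v] are images of integer sums. For the covering, an element outside the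
    new subgroup has a signed representative [s] that is not a multiple of [2n+1]; [A] supplies it
    up to sign when [2|s| < (2n+1)k], and [E] does otherwise. *)
Lemma extension_is_integer_heffter (n k q : nat) (A : heffter_cells n k k)
    (E : 'I_n -> 'I_n -> option int) :
  is_integer_heffter A ->
  (forall i j, E i j -> A i j = None) ->
  (forall i, #|[set j | isSome (E i j)]| = q) ->
  (forall j, #|[set i | isSome (E i j)]| = q) ->
  (forall i, \sum_j odflt 0 (E i j) = 0) ->
  (forall j, \sum_i odflt 0 (E i j) = 0) ->
  (forall i j z, E i j = Some z -> (2 * `|z| < (2 * n + 1) * (k + q))%N) ->
  (forall w : nat, ((2 * n + 1) * k < 2 * w)%N ->
    (2 * w < (2 * n + 1) * (k + q))%N -> ~~ ((2 * n + 1) %| w)%N ->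
    exists i j z, E i j = Some z /\ `|z|%N = w) ->
  (0 < q)%N ->
  is_integer_heffter (heffter_extension (k + q) A E).
Proof.
move=> [[[n0 k0 _ _] [rA cA] [J cJ Jcov] _ _] riA ciA].
move=> EA rE cE rsE csE Eb Ecov q0.
have vE : heffter_modulus n k k = ((2 * n + 1) * k)%N.
  by rewrite /heffter_modulus; lia.
have v'E : heffter_modulus n (k + q) (k + q) = ((2 * n + 1) * (k + q))%N.
  by rewrite /heffter_modulus; lia.
have v1 : (1 < heffter_modulus n k k)%N by rewrite vE; nia.
have vv' : (heffter_modulus n k k < heffter_modulus n (k + q) (k + q))%N.
  by rewrite vE v'E; nia.
have v'1 : (1 < heffter_modulus n (k + q) (k + q))%N by apply: ltn_trans vv'.
(* The integer value of a cell of the extended array; both the residue sums and the signed sums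
   reduce to sums of [I]. *)
pose I i j := oapp (@signed_rep _) 0 (A i j) + odflt 0 (E i j).
set A' := heffter_extension _ A E.
have A'N i j : isSome (A' i j) = isSome (A i j) || isSome (E i j).
  exact: heffter_extension_some.
have A'z i j : odflt 0 (A' i j) = (I i j)%:~R.
  rewrite mxE /I; move: (EA i j); case: (A i j) => [x|] /=.
    by case: (E i j) => [z /(_ isT)|_] //=; rewrite addr0.
  by case: (E i j) => [z|] //= _; rewrite add0r.
have A's i j : oapp (@signed_rep _) 0 (A' i j) = I i j.
  rewrite mxE /I; move: (EA i j) (Eb i j); case: (A i j) => [x|] /=.
    case: (E i j) => [z /(_ isT)|_ _] //=; rewrite addr0 intr_signed_rep //.
    exact: leq_ltn_trans (signed_rep_le x v1) vv'.
  case: (E i j) => [z|] //= _ /(_ z erefl) zb.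
  by rewrite add0r intr_signed_rep // v'E.
have rI i : \sum_j I i j = 0 by rewrite big_split /= riA rsE addr0.
have cI j : \sum_i I i j = 0 by rewrite big_split /= ciA csE addr0.
split; last 2 first.
- by move=> i; rewrite (eq_bigr _ (fun j _ => A's i j)).
- by move=> j; rewrite (eq_bigr _ (fun i _ => A's i j)).
have EA' i j : isSome (E i j) -> ~~ isSome (A i j) by move/EA ->.
split.
- by split; rewrite ?dvdn_mull // addn_gt0 k0.
- split=> [i|j].
    exact: card_line_extension (A'N i) (EA' i) (rA i) (rE i).
  exact: card_line_extension (A'N^~ j) (EA'^~ j) (cA j) (cE j).
- have [J' cJ' J'M] := subgroup_Zp_exists v'1 v'E.
  exists J' => // x xJ'.
  have xs := signed_repK x v'1; have sb := signed_rep_le x v'1.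
  move: (signed_rep x) xs sb => s xs sb.
  have sM : ~~ ((2 * n + 1) %| `|s|)%N.
    apply: contra xJ' => /J'M; rewrite -xs.
    case: (s) => m //=; rewrite NegzE mulrNz -pmulrn => H.
    rewrite -[- _]/((_ : 'Z_(heffter_modulus n (k + q) (k + q)))^-1)%g.
    by rewrite groupV.
  (* Since [2n+1] is odd, [2|s|] never hits the end points [(2n+1)k] and [(2n+1)(k+q)], so the weak
     inequalities become strict. *)
  have sN p : (2 * `|s| != (2 * n + 1) * p)%N.
    apply: contra sM => /eqP sE; rewrite -(@Gauss_dvdr _ 2) ?sE ?dvdn_mulr //.
    by rewrite coprime_sym coprime2n; lia.
  suff [i [j [z [A'ij zs]]]] :
      exists i j z, A' i j = Some z%:~R /\ `|z|%N = `|s|%N.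
    rewrite -xs; have [->|->] : s = z \/ s = - z by lia.
      by left; exists i, j.
    by right; exists i, j; rewrite mulrNz opprK.
  have [sv|vs] := ltnP (heffter_modulus n k k) (2 * `|s|)%N.
    have [||i [j [z [Eij zs]]]] := Ecov `|s|%N _ _ sM; first by rewrite -vE.
      by rewrite ltn_neqAle -v'E sb andbT v'E; apply: sN.
    by exists i, j, z; rewrite mxE EA Eij.
  have {}vs : (2 * `|s| < heffter_modulus n k k)%N.
    by rewrite ltn_neqAle vs andbT vE; apply: sN.
  have old z : occurs A z%:~R -> `|z|%N = `|s|%N ->
      exists i j z, A' i j = Some z%:~R /\ `|z|%N = `|s|%N.
    move=> [i [j Aij]] zs; exists i, j, z; split=> //.
    by rewrite mxE Aij intr_signed_rep // zs.
  case: (Jcov `|s|%:R) => [|sA|sA]; last 2 first.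
  - by apply: (old `|s|%:Z).
  - by apply: (old (- `|s|%:Z)); rewrite ?abszN // mulrNz.
  by apply: contra sM => /(dvdn_subgroup_Zp v1 vE cJ).
- by move=> i; rewrite (eq_bigr _ (fun j _ => A'z i j)) -rmorph_sum rI.
- by move=> j; rewrite (eq_bigr _ (fun i _ => A'z i j)) -rmorph_sum cI.
Qed.

(** All the conditions are invariant under a permutation of the columns. This serves to undo the
    rotation of a block diagonal array and to redo it after the extension. *)
Lemma colsub_is_integer_heffter (n k t : nat) (A : heffter_cells n k t)
    (f : 'I_n -> 'I_n) :
  injective f -> is_integer_heffter A ->
  is_integer_heffter (colsub f A : heffter_cells n k t).
Proof.
move=> fI [[pos [rA cA] [J cJ Jcov] rsA csA] riA ciA].
have occf x : occurs A x -> occurs (colsub f A) x.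
  by move=> [i [j Aij]]; exists i, (invF fI j); rewrite mxE f_invF.
split; [split=> // | |].
- split=> [i|j]; last by rewrite -[RHS](cA (f j));
    apply: eq_card => i; rewrite !inE mxE.
  rewrite -[RHS](rA i) -[RHS](card_preimset _ fI); apply: eq_card => j.
  by rewrite !inE mxE.
- by exists J => // x /Jcov[] /occf; [left | right].
- move=> i; rewrite -[RHS](rsA i) [RHS](reindex_inj fI).
  by apply: eq_bigr => j _; rewrite mxE.
- by move=> j; rewrite -[RHS](csA (f j)); apply: eq_bigr => i _; rewrite mxE.
- move=> i; rewrite -[RHS](riA i) [RHS](reindex_inj fI).
  by apply: eq_bigr => j _; rewrite mxE.
- by move=> j; rewrite -[RHS](ciA (f j)); apply: eq_bigr => i _; rewrite mxE.
Qed.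

(** * Numbering of the diagonals, and sums along rows and columns *)

(* On indices below n, the cell (r, c) lies on the diagonal number
   i + diag_offset n i r c; the summands n - c and n - i stand for -c and -i. *)
Definition diag_offset (n i r c : nat) : nat :=
  ((r + (n - c) + (n - i)) %% n)%N.

Section DiagOffset.
Variables (n : nat) (i : 'I_n).

Lemma ltn_diag_offset (r c : nat) : (diag_offset n i r c < n)%N.
Proof. by rewrite ltn_pmod // (leq_ltn_trans _ (ltn_ord i)). Qed.

Lemma diag_offsetK (r : nat) (c : 'I_n) :
  (i + diag_offset n i r c + c = r %[mod n])%N.
Proof.
rewrite /diag_offset -modnDml modnDmr modnDml.
have -> : (i + (r + (n - c) + (n - i)) + c = r + n + n)%N.
  by move: (ltn_ord i) (ltn_ord c); lia.
by rewrite !modnDr.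
Qed.

Lemma diag_offset_eq (r o : nat) (c : 'I_n) :
  (i + o + c = r %[mod n])%N -> diag_offset n i r c = (o %% n)%N.
Proof.
rewrite -(diag_offsetK r c) => /eqP; rewrite eqn_modDr eqn_modDl => /eqP->.
by rewrite modn_small ?ltn_diag_offset.
Qed.

(** With values in ['I_n], injectivity along a row or a column yields a permutation, by which sums
    can be reindexed by diagonals. *)
Definition diag_offset_ord (r c : nat) : 'I_n := Ordinal (ltn_diag_offset r c).

Lemma diag_offset_ord_injr (r : nat) :
  injective (fun c : 'I_n => diag_offset_ord r c).
Proof.
move=> c1 c2 /(congr1 val) /= oE; apply: val_inj => /=.
have := diag_offsetK r c1; rewrite oE -(diag_offsetK r c2) => /eqP.
by rewrite eqn_modDl !modn_small // => /eqP.
Qed.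

Lemma diag_offset_ord_injl (c : 'I_n) :
  injective (fun r : 'I_n => diag_offset_ord r c).
Proof.
move=> r1 r2 /(congr1 val) /= oE; apply: val_inj => /=.
have := diag_offsetK r1 c; rewrite oE diag_offsetK => /eqP.
by rewrite !modn_small // => /eqP.
Qed.

Lemma diag_offset_surj (r o : nat) :
  (o < n)%N -> exists c : 'I_n, diag_offset n i r c = o.
Proof.
move=> on; exists (invF (@diag_offset_ord_injr r) (Ordinal on)).
by have /(congr1 val) := f_invF (@diag_offset_ord_injr r) (Ordinal on).
Qed.

Lemma mem_diagonals (k : nat) (r c : 'I_n) : (k <= n)%N ->
  ((r, c) \in \bigcup_(j < k) diagonal n (i + j)) = (diag_offset n i r c < k)%N.
Proof.
move=> kn; apply/bigcupP/idP => [[j _]|ok].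
  rewrite inE /= => /eqP /esym /diag_offset_eq ->.
  by rewrite modn_small //; apply: leq_trans kn.
by exists (Ordinal ok) => //; rewrite inE /= diag_offsetK.
Qed.

Section Sums.
Variables (R : Type) (idx : R) (op : Monoid.com_law idx).

Lemma big_diag_offset_row (r : nat) (F : nat -> R) :
  \big[op/idx]_(c < n) F (diag_offset n i r c) = \big[op/idx]_(o < n) F o.
Proof. by rewrite [RHS](reindex_inj (@diag_offset_ord_injr r)). Qed.

Lemma big_diag_offset_col (c : 'I_n) (F : nat -> R) :
  \big[op/idx]_(r < n) F (diag_offset n i r c) = \big[op/idx]_(o < n) F o.
Proof. by rewrite [RHS](reindex_inj (@diag_offset_ord_injl c)). Qed.

(** After reindexing by diagonals, this reduces the sum of the added cells of a line to a sum over
    the [q] added diagonals, numbered [k] to [k+q-1]. *)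
Lemma big_band (k q : nat) (g : nat -> R) : (k + q <= n)%N ->
  \big[op/idx]_(o < n) (if (k <= o < k + q)%N then g (o - k)%N else idx) =
  \big[op/idx]_(l < q) g l.
Proof.
move=> kqn; rewrite -(big_mkord xpredT 
  (fun o => if (k <= o < k + q)%N then g (o - k)%N else idx)).
rewrite -(big_mkord xpredT g) (@big_cat_nat _ _ _ (k + q)) //=.
rewrite (@big_cat_nat _ _ _ k) ?leq_addr //= big_nat big1; last first.
  by move=> o /andP[_ ok]; rewrite leqNgt ok.
rewrite Monoid.mul1m [X in op _ X]big_nat [X in op _ X]big1; last first.
  by move=> o /andP[ko _]; rewrite (ltnNge o) ko andbF.
rewrite Monoid.mulm1 -{1}[k]add0n (addnC k) big_addn addnK.
by apply: eq_big_nat => o oq; rewrite leq_addl ltn_add2r oq addnK.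
Qed.

End Sums.
End DiagOffset.

Lemma big_pairs (R : Type) (idx : R) (op : Monoid.law idx) (N : nat)
    (G : nat -> R) :
  \big[op/idx]_(c < 2 * N) G c =
  \big[op/idx]_(b < N) op (G (2 * b)%N) (G (2 * b + 1)%N).
Proof.
rewrite -(big_mkord xpredT G); elim: N => [|N IH].
  by rewrite !big_ord0 big_geq.
rewrite mulnS !addSn add0n !big_nat_recr //= big_ord_recr IH /= addn1.
exact/esym/Monoid.mulmA.
Qed.

Lemma card_set_sum (n : nat) (p : pred 'I_n) :
  #|[set j | p j]| = (\sum_j p j)%N.
Proof.
rewrite -sum1_card big_mkcond; apply: eq_bigr => j _.
by rewrite inE; case: (p j).
Qed.

(** * Adding four consecutive diagonals *)

(** Here [e] and [h] stand for the parity and the half of [k]. The range splits into four intervals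
    of length [n]. For [e = 0] the multiple of [2n+1] inside it falls between the second and the
    third; for [e = 1] one falls after the first and one after the third, whence the shift
    [n + e]. *)
Lemma four_translates_cover (n h : nat) (e : bool) (w : nat) : (0 < n)%N ->
  ((2 * n + 1) * (e + h.*2) < 2 * w)%N ->
  (2 * w < (2 * n + 1) * (e + h.*2 + 4))%N ->
  ~~ (2 * n + 1 %| w)%N ->
  exists l t : nat, [/\ (l < 4)%N, (t < n)%N &
    w = (h * (2 * n + 1) + e * n + 1 + t +
         nth 0 [:: 0; n + e; 2 * n + 1; n + e + (2 * n + 1)] l)%N].
Proof.
move=> n0 w1 w2 wM.
have wq j : w != (j * (2 * n + 1))%N.
  by apply: contra wM => /eqP ->; rewrite dvdn_mull.
move: (wq h.+1) (wq h.+2) => {wM wq}.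
have [b bE] : exists b, b = (h * (2 * n + 1) + e * n + 1)%N by eexists.
have en : (e * n = 0 /\ e = 0 :> nat)%N \/ (e * n = n /\ e = 1 :> nat)%N.
  by case: (e); [right | left]; rewrite ?mul1n.
move=> wh1 wh2; have [?|?] := ltnP w (b + n)%N.
  by exists 0, (w - b)%N; rewrite /=; split => //; lia.
have [?|?] := ltnP w (b + n + e + n)%N.
  by exists 1, (w - b - n - e)%N; rewrite /=; split => //; lia.
have [?|?] := ltnP w (b + (2 * n + 1) + n)%N.
  by exists 2, (w - b - (2 * n + 1))%N; rewrite /=; split => //; lia.
exists 3, (w - b - n - e - (2 * n + 1))%N; rewrite /=.
by split => //; lia.
Qed.

(** In a row the four entries cancel identically. Down a column, consecutive diagonals meet
    consecutive rows, so the first two entries add up to [- p] and the last two to [p]. *)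
Lemma is_integer_heffter_add4_diagonals (n k : nat) (A : heffter_cells n k k) :
  (k + 4 <= n)%N -> is_integer_heffter A -> cyclically_diagonal k A ->
  exists A' : heffter_cells n (k + 4) (k + 4),
    is_integer_heffter A' /\ cyclically_diagonal (k + 4) A'.
Proof.
move=> kn hA [_ [i Ai]].
have {}Ai r c : isSome (A r c) = (diag_offset n i r c < k)%N.
  by rewrite Ai mem_diagonals //; lia.
pose p := (n + odd k)%N; pose q := (2 * n + 1)%N.
(* Taking the previous row on the second and fourth diagonals pairs each of
   them with the diagonal above it in every column. *)
pose x r := (k./2 * q + odd k * n + 1 + r)%N.
pose pr r := ((r + n.-1) %% n)%N.
pose val l r : int := nth 0 [:: (x r)%:Z; - (x (pr r) + p)%:Z; - (x r + q)%:Z;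
                              (x (pr r) + p + q)%:Z] l.
pose band o := (k <= o < k + 4)%N.
pose E (r c : 'I_n) : option int := let o := diag_offset n i r c in
  if band o then Some (val (o - k)%N r) else None.
have Es r c : odflt 0 (E r c) =
    let o := diag_offset n i r c in if band o then val (o - k)%N r else 0.
  by rewrite /E /=; case: ifP.
have Ec r c :
    isSome (E r c) = (if band (diag_offset n i r c) then 1 else 0)%N :> nat.
  by rewrite /E /=; case: ifP.
have prS a : pr ((a + 1) %% n)%N = (a %% n)%N.
  rewrite /pr modnDml; have -> : (a + 1 + n.-1 = a + n)%N by lia.
  by rewrite modnDr.
exists (heffter_extension (k + 4) A E); split; last first.
  split=> //; exists i => r c; rewrite mem_diagonals // mxE.
  move: (Ai r c); case: (A r c) => [y|] /=.
    by move/esym => ok; rewrite ltn_addr.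
  by rewrite /E /band /=; case: ltnP => //= _ _; case: ifP.
apply: extension_is_integer_heffter => //.
- move=> r c; have := Ai r c; rewrite /E /=; case: ifP => // /andP[ko _].
  by rewrite ltnNge ko; case: (A r c).
- move=> r; rewrite card_set_sum (eq_bigr _ (fun c _ => Ec r c)).
  rewrite (big_diag_offset_row i _ r (fun o => if band o then 1 else 0)%N).
  by rewrite (big_band _ (fun=> 1%N)) // sum1_card card_ord.
- move=> c; rewrite card_set_sum (eq_bigr _ (fun r _ => Ec r c)).
  rewrite (big_diag_offset_col i _ c (fun o => if band o then 1 else 0)%N).
  by rewrite (big_band _ (fun=> 1%N)) // sum1_card card_ord.
- move=> r; rewrite (eq_bigr _ (fun c _ => Es r c)) /=.
  rewrite (big_diag_offset_row i _ r
    (fun o => if band o then val (o - k)%N r else 0)).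
  rewrite (big_band _ (fun l => val l r)) // !big_ord_recl big_ord0 /val /=.
  by lia.
(* In a fixed column the diagonal determines the row, [i + o + c] modulo [n], so the entry is a
   function of [o] alone. *)
- move=> c; pose F o := val (o - k)%N ((i + o + c) %% n)%N.
  rewrite (eq_bigr (fun r : 'I_n => let o := diag_offset n i r c in
     if band o then F o else 0)); last first.
    by move=> r _; rewrite Es /F /= diag_offsetK modn_small.
  rewrite (big_diag_offset_col i _ c (fun o => if band o then F o else 0)).
  pose G l := val l ((i + k + c + l) %% n)%N.
  rewrite (eq_bigr (fun o : 'I_n => if band o then G (o - k)%N else 0));
    last first.
    move=> o _; case: ifP => // /andP[ko _]; rewrite /F /G.
    by congr (val _ (_ %% _)%N); lia.
  rewrite big_band // !big_ord_recr big_ord0 /G /val /=.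
  rewrite prS (_ : (_ + _ + 3 = i + k + c + 2 + 1)%N); last lia.
  by rewrite prS addn0; lia.
- move=> r c z; rewrite /E /=; case: ifP => // /andP[ko ok] [<-].
  have n0 : (0 < n)%N by lia.
  have pn : (pr r < n)%N by rewrite ltn_pmod.
  have rn := ltn_ord r.
  have kE := odd_double_half k.
  have {ok} : (diag_offset n i r c - k < 4)%N by lia.
  move: (_ - k)%N => l; rewrite /val /x /p /q; move: (pr r) pn => r' r'n.
  by case: (odd k) kE => kE; case: l => [|[|[|[|//]]]] _ /=; lia.
- move=> w w1 w2 wM.
  have n0 : (0 < n)%N by lia.
  have kE := odd_double_half k; rewrite -kE in w1 w2.
  have [l [t [l4 tn ->]]] := four_translates_cover n0 w1 w2 wM.
  (* On the second and fourth diagonals the entry of index [t] sits one row further, at [t + 1]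
     modulo [n]. *)
  have [r rt] : exists r : 'I_n, (if odd l then pr r else r) = t.
    case: (odd l); last by exists (Ordinal tn).
    by exists (Ordinal (ltn_pmod (t + 1) n0)); rewrite /= prS modn_small.
  have [c oc] : exists c : 'I_n, diag_offset n i r c = (k + l)%N.
    by apply: diag_offset_surj; lia.
  exists r, c, (val l r); split.
    by rewrite /E /band /= oc leq_addr ltn_add2l l4 addKn.
  rewrite /val /x /p /q.
  by case: l l4 rt {oc} => [|[|[|[|//]]]] _ /= <-; lia.
Qed.

(** * Adding diagonals of 2 x 2 blocks *)

Lemma rotate_columns_inj (n i : nat) : injective (iter i (@ordS n)).
Proof. by elim: i => [|i IH] a b //= /(can_inj (@ordSK _))/IH. Qed.

Lemma ltn_double_block (N : nat) (a : 'I_N) (x : 'I_2) : (a * 2 + x < 2 * N)%N.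
Proof. by move: (ltn_ord a) (ltn_ord x); lia. Qed.

(** The entry before its sign [(-1)^(x+y)], at position [(x, y)] of the block in block row [a] of
    the added block diagonal [l]: the values are [z], [z+u], [z+w], [z+u+w] with [z = base l a]. *)
Definition block_entry (base : nat -> nat -> int) (u w : nat -> int)
    (l a x y : nat) : int :=
  base l a + w l * x%:Z + u l * y%:Z.

(** A block on diagonal [l] contributes [-u l] or [u l] to a row, according to the parity of the
    row, and [-w l] or [w l] to a column. Hence the vanishing sums of [u] and of [w] make all lines
    vanish. *)
Lemma is_integer_heffter_add_blocks (n k d q : nat) (S : heffter_cells n k k)
    (base : nat -> nat -> int) (u w : nat -> int) :
  (0 < q)%N -> (2 * (d + q) <= n)%N ->
  is_integer_heffter S -> cyclically_block_diagonal 2 d S ->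
  \sum_(l < q) u l = 0 -> \sum_(l < q) w l = 0 ->
  (forall l a x y, (l < q)%N -> (a < n./2)%N -> (x < 2)%N -> (y < 2)%N ->
    (2 * `|block_entry base u w l a x y| < (2 * n + 1) * (k + 2 * q))%N) ->
  (forall z : nat, ((2 * n + 1) * k < 2 * z)%N ->
    (2 * z < (2 * n + 1) * (k + 2 * q))%N -> ~~ (2 * n + 1 %| z)%N ->
    exists l a x y, [/\ (l < q)%N, (a < n./2)%N, (x < 2)%N, (y < 2)%N &
      block_entry base u w l a x y = z]) ->
  exists S' : heffter_cells n (k + 2 * q) (k + 2 * q),
    is_integer_heffter S' /\ cyclically_block_diagonal 2 (d + q) S'.
Proof.
move=> q0 dqn hS [N [A0 [B [C [s [[dN [j A0j]] [nE A0N CB] SE]]]]]].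
move=> u0 w0 Vb Vcov.
subst n; have dqN : (d + q <= N)%N by lia.
have N2 : (2 * N)./2 = N by rewrite mul2n doubleK.
rewrite N2 in Vb Vcov.
have rI := @rotate_columns_inj (2 * N) s.
(* The extension is carried out on the unrotated array [C], whose blocks start at even indices. *)
have hC : is_integer_heffter (C : heffter_cells (2 * N) k k).
  have -> : C = colsub (invF rI) S.
    by apply/matrixP => r c; rewrite SE !mxE f_invF.
  by apply: colsub_is_integer_heffter => //; exact: can_inj (f_invF rI).
have half (r : 'I_(2 * N)) : (r %/ 2 < N)%N by move: (ltn_ord r); lia.
pose off (r c : nat) := diag_offset N j (r %/ 2) (c %/ 2).
have Coff (r c : 'I_(2 * N)) : isSome (C r c) -> (off r c < d)%N.
  pose a := Ordinal (half r); pose b := Ordinal (half c).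
  pose x := Ordinal (ltn_pmod r (isT : 0 < 2)%N).
  pose y := Ordinal (ltn_pmod c (isT : 0 < 2)%N).
  rewrite (CB a b x y) /=; try exact: divn_eq.
  have := A0j a b; rewrite mem_diagonals // => <-.
  by case E: (A0 a b) => //; rewrite A0N // mxE.
pose band o := (d <= o < d + q)%N.
(* As blocks start at even indices, the sign [(-1)^(r+c)] is the sign [(-1)^(x+y)] inside the
   block. *)
pose En (r c : nat) : option int := if band (off r c) then
  Some ((-1) ^+ (r + c) *
        block_entry base u w (off r c - d) (r %/ 2) (r %% 2) (c %% 2))
  else None.
have off_row r b : [/\ off r (2 * b)%N = diag_offset N j (r %/ 2) b,
    off r (2 * b + 1)%N = diag_offset N j (r %/ 2) b,
    (2 * b %% 2 = 0)%N & ((2 * b + 1) %% 2 = 1)%N].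
  by rewrite /off; split; try (congr diag_offset); lia.
have off_col a c : [/\ off (2 * a)%N c = diag_offset N j a (c %/ 2),
    off (2 * a + 1)%N c = diag_offset N j a (c %/ 2),
    (2 * a %/ 2 = a)%N & ((2 * a + 1) %/ 2 = a)%N].
  by rewrite /off; split; try (congr diag_offset); lia.
have Ecard_row r b : (isSome (En r (2 * b)) + isSome (En r (2 * b + 1)) =
    if band (diag_offset N j (r %/ 2) b) then 2 else 0)%N.
  by have [o1 o2 _ _] := off_row r b; rewrite /En o1 o2; case: ifP.
have Ecard_col a c : (isSome (En (2 * a) c) + isSome (En (2 * a + 1) c) =
    if band (diag_offset N j a (c %/ 2)) then 2 else 0)%N.
  by have [o1 o2 _ _] := off_col a c; rewrite /En o1 o2; case: ifP.
have sgn m a : (-1) ^+ (m + 2 * a) = (-1) ^+ m :> int.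
  by rewrite exprD exprM sqrrN !expr1n mulr1.
have Esum_row r b : odflt 0 (En r (2 * b)%N) + odflt 0 (En r (2 * b + 1)%N) =
    if band (diag_offset N j (r %/ 2) b)
    then - (-1) ^+ r * u (diag_offset N j (r %/ 2) b - d)%N else 0.
  have [o1 o2 m1 m2] := off_row r b; rewrite /En o1 o2; case: ifP => //= _.
  rewrite m1 m2 /block_entry addnA [in X in _ + X]addn1 exprS sgn.
  by ring.
have Esum_col a c : odflt 0 (En (2 * a)%N c) + odflt 0 (En (2 * a + 1)%N c) =
    if band (diag_offset N j a (c %/ 2))
    then - (-1) ^+ c * w (diag_offset N j a (c %/ 2) - d)%N else 0.
  have [o1 o2 d1 d2] := off_col a c; rewrite /En o1 o2; case: ifP => //= _.
  have [_ _ m1 m2] := off_row 0 a; rewrite d1 d2 m1 m2.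
  rewrite /block_entry [in X in _ + X]addn1 addSn exprS addnC sgn.
  by ring.
pose E (r c : 'I_(2 * N)) := En r c.
pose C' := heffter_extension (k + 2 * q) (C : heffter_cells (2 * N) k k) E.
have C'off (r c : 'I_(2 * N)) : isSome (C' r c) -> (off r c < d + q)%N.
  rewrite heffter_extension_some => /orP[/Coff|]; first exact: ltn_addr.
  by rewrite /E /En; case: ifP => // /andP[].
exists (rotate_columns s C'); split.
  apply: colsub_is_integer_heffter => //.
  apply: extension_is_integer_heffter => //.
  - move=> r c; rewrite /E /En; case: ifP => // /andP[ko _] _.
    by have := @Coff r c; case: (C r c) => // y /(_ isT); rewrite ltnNge ko.
  - move=> r; rewrite card_set_sum.
    rewrite (big_pairs _ _ (fun c => isSome (En r c) : nat)).
    rewrite (eq_bigr _ (fun (b : 'I_N) _ => Ecard_row r b)).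
    rewrite (big_diag_offset_row j _ (r %/ 2)
      (fun o => if band o then 2 else 0)%N).
    by rewrite (big_band _ (fun=> 2%N)) // sum_nat_const card_ord mulnC.
  - move=> c; rewrite card_set_sum.
    rewrite (big_pairs _ _ (fun r => isSome (En r c) : nat)).
    rewrite (eq_bigr _ (fun (a : 'I_N) _ => Ecard_col a c)).
    rewrite (big_diag_offset_col j _ (Ordinal (half c))
      (fun o => if band o then 2 else 0)%N).
    by rewrite (big_band _ (fun=> 2%N)) // sum_nat_const card_ord mulnC.
  - move=> r; rewrite (big_pairs _ _ (fun c => odflt 0 (En r c))).
    rewrite (eq_bigr _ (fun (b : 'I_N) _ => Esum_row r b)).
    rewrite (big_diag_offset_row j _ (r %/ 2)
      (fun o => if band o then _ * u (o - d)%N else 0)).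
    by rewrite (big_band _ (fun l => _ * u l)) // -mulr_sumr u0 mulr0.
  - move=> c; rewrite (big_pairs _ _ (fun r => odflt 0 (En r c))).
    rewrite (eq_bigr _ (fun (a : 'I_N) _ => Esum_col a c)).
    rewrite (big_diag_offset_col j _ (Ordinal (half c))
      (fun o => if band o then _ * w (o - d)%N else 0)).
    by rewrite (big_band _ (fun l => _ * w l)) // -mulr_sumr w0 mulr0.
  - move=> r c z; rewrite /E /En; case: ifP => // /andP[ko ok] [<-].
    by rewrite abszM abszX exp1n mul1n; apply: Vb; rewrite ?ltn_pmod //; lia.
  - move=> z z1 z2 zM; have [l [a [x [y [lq aN x2 y2 Vz]]]]] := Vcov z z1 z2 zM.
    have [b bo] : exists b : 'I_N, diag_offset N j a b = (d + l)%N.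
      by apply: diag_offset_surj; lia.
    exists (Ordinal (ltn_double_block (Ordinal aN) (Ordinal x2))).
    exists (Ordinal (ltn_double_block b (Ordinal y2))).
    exists ((-1) ^+ (a * 2 + x + (b * 2 + y)) * block_entry base u w l a x y).
    split; last by rewrite abszM abszX exp1n mul1n Vz.
    rewrite /E /En /off /= !divnMDl // !divn_small // !addn0 bo /band.
    rewrite leq_addr ltn_add2l lq addKn.
    by rewrite !modnMDl !modn_small.
  - by rewrite muln_gt0.
(* Only the pattern of empty cells of this array matters, so its filled cells hold 0; the blocks are
   cut out of [C']. *)
exists N, (\matrix_(a, b)
  if (diag_offset N j a b < d + q)%N then Some 0 else None).
exists (fun a b => \matrix_(x, y)
  C' (Ordinal (ltn_double_block a x)) (Ordinal (ltn_double_block b y))).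
exists C', s; split=> //.
  split=> //; exists j => r c; rewrite mem_diagonals // mxE.
  by case: ifP.
split=> // [a b|a b x y r c rE cE].
  rewrite mxE; case: ltnP => // ab _; apply/matrixP => x y.
  rewrite [RHS]mxE mxE; case CE: (C' _ _) => //.
  move/eqP/eqP: CE => /(congr1 isSome) /C'off.
  by rewrite /off /= !divnMDl // !divn_small // !addn0 ltnNge ab.
by rewrite mxE; congr (C' _ _); apply: val_inj.
Qed.

(** * Explicit blocks for two and for three added diagonals *)

Lemma cyclically_block_diagonal_dvdn (T : Type) (n s k : nat)
    (S : pf_array T n n) :
  cyclically_block_diagonal s k S -> (s %| n)%N.
Proof.
case=> N [A [B [C [i [_ [nE _ _] _]]]]].
by apply/dvdnP; exists N; rewrite nE mulnC.
Qed.

(** Relative to [m], the lower end of the range, the first diagonal fills [[1, 2n]] and the second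
    [[2n+2, 4n+1]]. As [u] and [w] are negative on the second, its [base] is the largest value of
    the block. *)
Lemma is_integer_heffter_add2_block_diagonals (n d : nat)
    (S : heffter_cells n (2 * d) (2 * d)) :
  (2 * d + 4 <= n)%N -> is_integer_heffter S ->
  cyclically_block_diagonal 2 d S ->
  exists S' : heffter_cells n (2 * d + 4) (2 * d + 4),
    is_integer_heffter S' /\ cyclically_block_diagonal 2 (d + 2) S'.
Proof.
move=> dn hS bS; have [N nE] := dvdnP (cyclically_block_diagonal_dvdn bS).
pose m := (d * (2 * n + 1))%N.
pose base l a : int := nth 0 [:: (m + 1 + 2 * a)%:Z;
                                 (m + 3 * n + 3 + 2 * a)%:Z] l.
pose u l : int := nth 0 [:: 1; -1] l.
pose w l : int := nth 0 [:: n%:Z; - n%:Z] l.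
apply: (@is_integer_heffter_add_blocks _ _ _ 2 _ base
  u w _ _ hS bS) => //; first by lia.
- by rewrite !big_ord_recl big_ord0.
- by rewrite !big_ord_recl big_ord0 /w /=; lia.
- move=> l a x y l2 aN x2 y2; rewrite /block_entry /base /u /w /m.
  by case: x y l x2 y2 l2 => [|[|//]] [|[|//]] [|[|//]] _ _ _ /=; lia.
- move=> z z1 z2 zM.
  (* This is [m + 2n+1], the only multiple of [2n+1] in the range. *)
  have zd : z != (d.+1 * (2 * n + 1))%N.
    by apply: contra zM => /eqP ->; rewrite dvdn_mull.
  pose t := (z - m)%N; rewrite /block_entry /base /u /w.
  have [?|?] := leqP t n.
    exists 0%N, ((t - 1) %/ 2)%N, 0%N, ((t - 1) %% 2)%N.
    by split=> //=; rewrite ?/m; lia.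
  have [?|?] := leqP t (2 * n).
    exists 0%N, ((t - n - 1) %/ 2)%N, 1%N, ((t - n - 1) %% 2)%N.
    by split=> //=; rewrite ?/m; lia.
  have [?|?] := leqP t (3 * n + 1).
    (* Here [u = -1], so the parity is reversed to obtain [y]. *)
    exists 1%N, ((t - 2 * n - 2) %/ 2)%N, 1%N, (1 - (t - 2 * n - 2) %% 2)%N.
    by split=> //=; rewrite ?/m; lia.
  exists 1%N, ((t - 3 * n - 2) %/ 2)%N, 0%N, (1 - (t - 3 * n - 2) %% 2)%N.
  by split=> //=; rewrite ?/m; lia.
Qed.

(** Relative to [m] the range is [[n+1, 7n+3]] without [2n+1], [4n+2], [6n+3]. Diagonal 2 fills
    [[n+1, 2n]] and [[2n+2, 3n+1]], diagonal 1 fills [[4n+3, 6n+2]], and diagonal 0 fills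
    [[3n+2, 4n+1]] and [[6n+4, 7n+3]]. *)
Lemma is_integer_heffter_add3_block_diagonals (n d : nat)
    (S : heffter_cells n (2 * d + 1) (2 * d + 1)) :
  (n = 0 %[mod 4])%N -> (0 < n)%N -> (2 * (d + 1 + 3) <= n)%N ->
  is_integer_heffter S -> cyclically_block_diagonal 2 (d + 1) S ->
  exists S' : heffter_cells n (2 * d + 7) (2 * d + 7),
    is_integer_heffter S' /\ cyclically_block_diagonal 2 (d + 1 + 3) S'.
Proof.
rewrite mod0n => n4 n0 dn hS bS.
have {n4} [h nE] : exists h, n = (4 * h)%N by exists (n %/ 4)%N; lia.
pose m := (d * (2 * n + 1))%N.
(* With [(u, w) = (-2, 1)] a block consists of [quad a - 2] to [quad a + 1]. The first [h] blocks
   tile one interval of length [n = 4h], the last [h] the other. *)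
pose quad a := if (a < h)%N then (3 * n + 4 + 4 * a)%N
  else (6 * n + 6 + 4 * (a - h))%N.
pose base l a : int := nth 0 [:: (m + quad a)%:Z; (m + 4 * n + 3 + 2 * a)%:Z;
                                 (m + 2 * n + 2 + 2 * a)%:Z] l.
pose u l : int := nth 0 [:: -2; 1; 1] l.
pose w l : int := nth 0 [:: 1; n%:Z; - (n + 1)%:Z] l.
have -> : (2 * d + 7 = 2 * d + 1 + 2 * 3)%N by lia.
apply: (@is_integer_heffter_add_blocks _ _ _ 3 _ base u w _ _ hS bS) => //.
- by rewrite !big_ord_recl big_ord0.
- by rewrite !big_ord_recl big_ord0 /w /=; lia.
- move=> l a x y l2 aN x2 y2; rewrite /block_entry /base /u /w /m /quad.
  case: x y l x2 y2 l2 => [|[|//]] [|[|//]] [|[|[|//]]] _ _ _ /=;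
    by try case: ifP => ?; lia.
- move=> z z1 z2 zM.
  have zd j : z != (j * (2 * n + 1))%N.
    by apply: contra zM => /eqP ->; rewrite dvdn_mull.
  move: (zd d.+1) (zd d.+2) (zd d.+3) => {zd zM} zd1 zd2 zd3.
  pose t := (z - m)%N; rewrite /block_entry /base /u /w /quad.
  have [?|?] := leqP t (2 * n).
    exists 2%N, ((t - n - 1) %/ 2)%N, 1%N, ((t - n - 1) %% 2)%N.
    by split=> //=; rewrite ?/m; lia.
  have [?|?] := leqP t (3 * n + 1).
    exists 2%N, ((t - 2 * n - 2) %/ 2)%N, 0%N, ((t - 2 * n - 2) %% 2)%N.
    by split=> //=; rewrite ?/m; lia.
  have [?|?] := leqP t (4 * n + 1).
    pose s := (t - 3 * n - 2)%N.
    (* The value [2 + x - 2y] is the position in the quadruple, so [x] and [1 - y] are the binary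
       digits of [s] modulo 4. *)
    exists 0%N, (s %/ 4)%N, (s %% 2)%N, (1 - s %% 4 %/ 2)%N.
    have -> : (s %/ 4 < h)%N by rewrite /s; lia.
    by split=> //=; rewrite ?/m /s; lia.
  have [?|?] := leqP t (5 * n + 2).
    exists 1%N, ((t - 4 * n - 3) %/ 2)%N, 0%N, ((t - 4 * n - 3) %% 2)%N.
    by split=> //=; rewrite ?/m; lia.
  have [?|?] := leqP t (6 * n + 2).
    exists 1%N, ((t - 5 * n - 3) %/ 2)%N, 1%N, ((t - 5 * n - 3) %% 2)%N.
    by split=> //=; rewrite ?/m; lia.
  pose s := (t - 6 * n - 4)%N.
  exists 0%N, (h + s %/ 4)%N, (s %% 2)%N, (1 - s %% 4 %/ 2)%N.
  have -> : (h + s %/ 4 < h)%N = false by rewrite /s; lia.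
  by split=> //=; rewrite ?/m /s; lia.
Qed.

Local Close Scope ring_scope.
Unset Implicit Arguments.

Theorem theorem4p17 (n k d : nat)
    (hn : (0 < n)%N) (hk : (0 < k)%N) (hd : (0 < d)%N) :
  [/\ (k + 4 <= n)%N ->
      (exists A : heffter_cells n k k,
         is_integer_heffter A /\ cyclically_diagonal k A) ->
      exists A : heffter_cells n (k + 4) (k + 4),
        is_integer_heffter A /\ cyclically_diagonal (k + 4) A,
      (2 * d + 4 <= n)%N ->
      (exists A : heffter_cells n (2 * d) (2 * d),
         is_integer_heffter A /\ cyclically_block_diagonal 2 d A) ->
      exists A : heffter_cells n (2 * d + 4) (2 * d + 4),
        is_integer_heffter A /\ cyclically_block_diagonal 2 (d + 2) A
    & (n = 0 %[mod 4])%N -> (2 * d + 6 <= n)%N ->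
      (exists A : heffter_cells n (2 * d - 1) (2 * d - 1),
         is_integer_heffter A /\ cyclically_block_diagonal 2 d A) ->
      exists A : heffter_cells n (2 * d + 5) (2 * d + 5),
        is_integer_heffter A /\ cyclically_block_diagonal 2 (d + 3) A].
Proof.
split.
- by move=> kn [A [hA dA]]; exact: is_integer_heffter_add4_diagonals hA dA.
- move=> dn [A [hA dA]].
  exact: is_integer_heffter_add2_block_diagonals hA dA.
(* Writing [d] as a successor removes the truncated subtraction in [2d - 1]. *)
- case: d hd => // d _ n4 dn.
  have -> : (2 * d.+1 - 1 = 2 * d + 1)%N by lia.
  have -> : (2 * d.+1 + 5 = 2 * d + 7)%N by lia.
  move=> [A [hA dA]]; rewrite -[d.+1]addn1 in dn dA *.
  by apply: is_integer_heffter_add3_block_diagonals hA dA => //; lia.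
Qed.
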